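(* Let $U\in\mathbb{C}^{M\times M}$ be unitary with orthonormal eigenvectors $|\psi_0\rangle,\dots,|\psi_{M-1}\rangle$ and eigenvalues $e^{\mathrm{i}\lambda_0},\dots,e^{\mathrm{i}\lambda_{M-1}}$, let $|\psi\rangle$ be a unit vector, and let $p_0=|\langle\psi|\psi_0\rangle|^2$. Let $\epsilon\in(0,1)$ and $\eta\in(0,1)$. Suppose the constant $\delta$ satisfies $\delta<2\sqrt3-3$, that $p_0>1-\delta>4-2\sqrt3$, and that $$N_s=2\left\lceil\frac{4}{\alpha(\delta)^2}\left(\log\frac4\eta+\log\left(\left\lceil\log_2\frac1\epsilon\right\rceil+1\right)\right)\right\rceil,\qquad \alpha(\delta)=\frac{\sqrt3}{2}(1-\delta)-\delta .$$ Run the robust phase estimation algorithm described in the context with $J=\lceil\log_2(\epsilon^{-1})\rceil$ and this $N_s$. Then its output $\theta_J$ satisfies $$\mathbb{P}\left(|\theta_J-\lambda_0|_{2\pi}<\frac{\pi}{3}\epsilon\right)>1-\eta .$$ In addition, the maximal runtime and the total cost of the algorithm are, respectively, $$T_{\max}=\mathcal{O}\left(\epsilon^{-1}\right),\qquad T_{\mathrm{total}}=\mathcal{O}\left(\epsilon^{-1}\left(\log(\eta^{-1})+\log\log(\epsilon^{-1})\right)\right)$$ (as $\epsilon\to0$, for fixed $\delta$, uniformly in $\eta\in(0,1)$).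
   Context: Angles are understood modulo $2\pi$, and $|\theta|_{2\pi}=\pi-|(\theta \bmod 2\pi)-\pi|$ is the distance from $\theta$ to $0$ modulo $2\pi$. $\arg$ denotes the principal argument (with an arbitrary value assigned to $\arg 0$). $\log$ is the natural logarithm. Hadamard test. For an integer $j\ge0$, one run of the ''real part'' circuit returns a random variable with values in $\{+1,-1\}$ and expectation $\mathrm{Re}\,\langle\psi|U^{2^j}|\psi\rangle$; one run of the ''imaginary part'' circuit returns a random variable with values in $\{+1,-1\}$ and expectation $\mathrm{Im}\,\langle\psi|U^{2^j}|\psi\rangle$. All runs are independent. Each such run has circuit depth (cost) $2^j$, i.e. the number of uses of (controlled) $U$. Algorithm (parameters $J$ and even $N_s$). Set $\theta_{-1}=0$. For $j=0,1,\dots,J$: (1) run the real part circuit for $U^{2^j}$ $N_s/2$ times and the imaginary part circuit $N_s/2$ times, and let $Z_j=X_j+\mathrm{i}Y_j$, where $X_j$ and $Y_j$ are the empirical averages of the real part and imaginary part outcomes, respectively; (2) let $S_j=\left\{\frac{2k\pi+\arg Z_j}{2^j}: k=0,\dots,2^j-1\right\}$; (3) let $\theta_j=\arg\min_{\theta\in S_j}|\theta-\theta_{j-1}|_{2\pi}$ (ties broken arbitrarily). Output $\theta_J$. $T_{\max}$ is the maximal depth of any circuit run in the algorithm, and $T_{\mathrm{total}}$ is the sum of the circuit depths over all runs. *)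

(* Defs.v *)
From mathcomp Require Import all_boot all_order all_algebra.
From mathcomp Require Import complex.
From mathcomp Require Import all_classical all_reals all_analysis.
Import Order.TTheory GRing.Theory Num.Theory.
Import numFieldNormedType.Exports.

Set Implicit Arguments.
Unset Strict Implicit.
Unset Printing Implicit Defensive.

Local Open Scope classical_set_scope.
Local Open Scope complex_scope.
Local Open Scope ring_scope.
Local Open Scope sesquilinear_scope.

Section Angles.
Context {R : realType}.
Implicit Types (x y theta : R) (z : R[i]).

Definition modr x y : R := x - (Num.floor (x / y))%:~R * y.

Definition angle_dist theta : R := pi - `|modr theta (2 * pi) - pi|.

Definition expi theta : R[i] := cos theta +i* sin theta.

(* No constraint is put on the value at 0, which is thus arbitrary. *)
Definition is_principal_arg (arg : R[i] -> R) : Prop :=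
  forall z, z != 0 ->
    [/\ - pi < arg z, arg z <= pi & z = (Normc.normc z)%:C * expi (arg z)].

Definition log2 x : R := ln x / ln 2.

(* The ceiling as a natural number, meaningful for arguments > -1. *)
Definition nceil x : nat := `|Num.ceil x|%N.

End Angles.

Section Braket.
Context {R : realType} {M : nat}.
Implicit Types u v psi : 'cV[R[i]]_M.

(* Antilinear in the first argument. *)
Definition braket u v : R[i] := (u ^t* *m v) 0 0.

Definition orthonormal_family (psis : 'I_M -> 'cV[R[i]]_M) : Prop :=
  forall k l, braket (psis k) (psis l) = (k == l)%:R.

End Braket.

Section Independence.
Context {d : measure_display} {T : measurableType d} {R : realType}.

Definition mutually_independent (P : probability T R) (I : finType)
    (X : I -> {RV P >-> R}) : Prop :=
  forall (A : {set I}) (B : I -> set R), (forall i, measurable (B i)) ->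
    P (\bigcap_(i in [set` A]) (X i @^-1` B i)) =
    (\prod_(i in A) P (X i @^-1` B i))%E.

End Independence.

(* The indices of the runs: run [(j, b, n)] is the [n]-th repetition, for
   [U ^+ 2 ^ j], of the real part circuit if [b = false], and of the imaginary
   part circuit if [b = true]. *)
Definition rpe_run (J Ns : nat) : finType := ('I_J.+1 * bool * 'I_(Ns./2))%type.

Definition run_depth (J Ns : nat) (r : rpe_run J Ns) : nat := (2 ^ r.1.1)%N.

Definition T_max (J Ns : nat) : nat :=
  (\max_(r : rpe_run J Ns) run_depth r)%N.

Definition T_total (J Ns : nat) : nat :=
  (\sum_(r : rpe_run J Ns) run_depth r)%N.

Section RobustPhaseEstimation.
Context {R : realType}.

Definition rpe_alpha (delta : R) : R :=
  Num.sqrt 3 / 2 * (1 - delta) - delta.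

Definition rpe_J (eps : R) : nat := nceil (log2 eps^-1).

Definition rpe_Ns (delta eps eta : R) : nat :=
  (2 * nceil (4 / rpe_alpha delta ^+ 2 *
              (ln (4 / eta) + ln ((nceil (log2 eps^-1))%:R + 1))))%N.

(* The pairs [(eps, eta)] with [eps] tending to 0 from the right, uniformly in
   [eta] in the open unit interval. *)
Definition eps_to_0_unif_eta : filter_on (R * R) :=
  FilterType (filter_prod (0 : R)^'+ (globally [set eta : R | 0 < eta < 1])) _.

Section Algorithm.
Context {d : measure_display} {T : measurableType d} {P : probability T R}.

Definition hadamard_tests (M : nat) (U : 'M[R[i]]_M) (psi : 'cV[R[i]]_M)
    (J Ns : nat) (X : rpe_run J Ns -> {RV P >-> R}) : Prop :=
  [/\ forall r w, X r w = 1 \/ X r w = -1,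
      forall (j : 'I_J.+1) (b : bool) (n : 'I_(Ns./2)),
        let z := braket psi (U ^+ (2 ^ j) *m psi) in
        ('E_P[X (j, b, n)] = (if b then complex.Im z else complex.Re z)%:E)%E
    & mutually_independent X].

Definition rpe_Z (J Ns : nat) (X : rpe_run J Ns -> {RV P >-> R})
    (j : 'I_J.+1) (w : T) : R[i] :=
  let average b := (\sum_(n < Ns./2) X (j, b, n) w) / (Ns./2)%:R in
  average false +i* average true.

Definition rpe_candidates (arg : R[i] -> R) (z : R[i]) (j : nat) : set R :=
  [set theta | exists2 k : nat, (k < 2 ^ j)%N &
     theta = (2 * k%:R * pi + arg z) / 2 ^+ j].

(* [theta j] is a random variable, and a pointwise minimizer; ties may be
   broken in any measurable, possibly randomized, way. *)
Definition rpe_output (arg : R[i] -> R) (J Ns : nat)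
    (X : rpe_run J Ns -> {RV P >-> R}) (theta : nat -> {RV P >-> R}) : Prop :=
  forall (j : 'I_J.+1) (w : T),
    let prev : R := if j : nat is i.+1 then theta i w else 0 in
    let S := rpe_candidates arg (rpe_Z X j w) j in
    S (theta j w) /\
    forall t, S t -> angle_dist (theta j w - prev) <= angle_dist (t - prev).

End Algorithm.

End RobustPhaseEstimation.

(* Main.v *)
(* Let z_j = <psi|U^(2^j)|psi>. Expanding psi in the eigenbasis gives
   |z_j - p0 e^(i 2^j lambda_0)| <= 1 - p0. If both averages are within
   alpha(1 - p0) / sqrt 2 of their means, then |Z_j - p0 e^(i 2^j lambda_0)| is less
   than alpha(1 - p0) + (1 - p0) = (sqrt 3 / 2) p0, and so arg Z_j is within pi/3 of
   2^j lambda_0. If this holds for all j, then |theta_j - lambda_0| < pi / (3 * 2^j) by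
   induction: some candidate is that close to lambda_0, hence within pi / 2^j of
   theta_(j-1); thus theta_j is within 5 pi / (3 * 2^j) of lambda_0, which leaves no
   room for a nonzero multiple of 2 pi / 2^j.
   Hoeffding's inequality for each of the 2 (J + 1) averages and a union bound show that
   this fails with probability at most 4 (J + 1) exp (- Ns alpha(1 - p0)^2 / 8), which is
   less than eta since alpha(1 - p0) > alpha(delta). *)
Require Import Defs.
From mathcomp Require Import all_boot all_order all_algebra.
From mathcomp Require Import complex.
From mathcomp Require Import all_classical all_reals all_analysis.
From mathcomp Require Import measurable_realfun ring lra.
Import Order.TTheory GRing.Theory Num.Theory.
Import numFieldNormedType.Exports.

Set Implicit Arguments.
Unset Strict Implicit.
Unset Printing Implicit Defensive.

Local Open Scope classical_set_scope.
Local Open Scope complex_scope.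
Local Open Scope ring_scope.

(** * Angles modulo 2 pi *)

Lemma periodic_int (R : realType) (f : R -> R) (c : R) :
  periodic f c -> forall (m : int) x, f (x + m%:~R * c) = f x.
Proof.
move=> fc [n|n] x; first by rewrite -pmulrn mulr_natl periodicn.
by rewrite NegzE rmorphN /= mulNr -{2}(subrK (n.+1%:~R * c) x) -pmulrn mulr_natl
  periodicn.
Qed.

Section Angle.
Context {R : realType}.
Implicit Types (x t : R) (m : int) (z : R[i]).

Lemma modr_bound x : 0 <= modr x (2 * pi) < 2 * pi.
Proof.
have p0 : (0 : R) < 2 * pi by rewrite mulr_gt0 // pi_gt0.
rewrite /modr subr_ge0 -ler_pdivlMr // ltrBlDl.
by rewrite -[X in _ + X]mul1r -mulrDl -ltr_pdivrMr // -intrD1 floorD1_gt andbT floor_le.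
Qed.

(** With r the remainder of x, pi - |r - pi| is the smaller of r and 2 pi - r. A multiple of 2 pi up
    to the floor is at least r away from x, one beyond it at least 2 pi - r. *)
Lemma angle_dist_le x m : angle_dist x <= `|x - m%:~R * (2 * pi)|.
Proof.
have p0 := pi_gt0 R; have := modr_bound x; rewrite /angle_dist /modr.
have pi2 : 0 <= 2 * pi :> R by rewrite mulr_ge0 // ltW.
move: (Num.floor _) => f; have [mf|fm] := leP m f.
  have : (m%:~R : R) * (2 * pi) <= f%:~R * (2 * pi).
    by rewrite ler_wpM2r // ler_int.
  move: (_%:~R * _) (_%:~R * _) => F G FG /andP[F0 F1].
  have := ler_norm (x - G - pi); have := ler_norm (- (x - G - pi)).
  by rewrite normrN (ger0_norm (x := x - F)); lra.
have : (f%:~R + 1) * (2 * pi) <= (m%:~R : R) * (2 * pi).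
  by rewrite ler_wpM2r // -intrD1 ler_int lezD1.
rewrite mulrDl; move: (_%:~R * _) (_%:~R * _) => G F FG /andP[F0 F1].
have := ler_norm (x - F - pi); have := ler_norm (- (x - F - pi)).
by rewrite normrN (ler0_norm (x := x - G)); lra.
Qed.

(** The nearest multiple is given by the floor or its successor, as the remainder is at most pi or
    not. Together with [angle_dist_le] this makes [angle_dist] the distance to the lattice of
    multiples of 2 pi. *)
Lemma angle_dist_eq x : exists m, angle_dist x = `|x - m%:~R * (2 * pi)|.
Proof.
have p0 := pi_gt0 R; have := modr_bound x; rewrite /angle_dist /modr.
move: (Num.floor _) => f /andP[f0 f1].
have [h|h] := leP (x - f%:~R * (2 * pi)) pi.
  by exists f; move: f0 f1 h; move: (_%:~R * _) => F f0 f1 h;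
    rewrite ler0_norm ?ger0_norm //; lra.
exists (f + 1); rewrite intrD1 [(f%:~R + 1) * _]mulrDl mul1r; move: f0 f1 h.
move: (_%:~R * _) => F f0 f1 h.
by rewrite ger0_norm ?ler0_norm; lra.
Qed.

Lemma angle_dist_le_pi x : angle_dist x <= pi.
Proof. by rewrite /angle_dist gerBl. Qed.

Lemma angle_dist_ltP x c :
  (angle_dist x < c) <-> (exists m, `|x - m%:~R * (2 * pi)| < c).
Proof.
split=> [xc|[m]]; last exact: le_lt_trans (angle_dist_le _ _).
by have [m e] := angle_dist_eq x; exists m; rewrite -e.
Qed.

(** A countable union of balls around the translates of l; this makes the success event
    measurable. *)
Lemma measurable_angle_dist_lt (l c : R) :
  measurable [set t : R | angle_dist (t - l) < c].
Proof.
have -> : [set t : R | angle_dist (t - l) < c] =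
    \bigcup_(m : int) ball (l + m%:~R * (2 * pi)) c.
  apply/seteqP; split=> t /=.
    move=> /angle_dist_ltP[m h]; exists m => //.
    by rewrite /ball /= distrC opprD addrA.
  case=> m _; rewrite /ball /= distrC opprD addrA => h.
  by apply/angle_dist_ltP; exists m.
apply: countable_bigcupT_measurable => [|m].
  exact: countableP.
exact: measurable_ball.
Qed.

Lemma cosD2pi_int x m : cos (x + m%:~R * (2 * pi)) = cos x :> R.
Proof. by apply: periodic_int => y; rewrite mulr_natl cosD2pi. Qed.

Lemma cos_pithird : cos (pi / 3) = 1 / 2 :> R.
Proof.
have p0 := pi_gt0 R; set a : R := pi / 3.
have c0 : 0 < cos a by apply: cos_gt0_pihalf; rewrite /a; apply/andP; split; lra.
(* The triple angle formula turns cos (3 a) = -1 into (2 c - 1)^2 (c + 1) = 0 for c = cos a, and c >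
   0 excludes -1. *)
have : cos (a *+ 2 + a) = -1 by rewrite -cospi; congr cos; rewrite /a; lra.
rewrite cosD cos_mulr2n sin_mulr2n.
have -> : (cos a * sin a) *+ 2 * sin a = 2 * cos a * sin a ^+ 2 by ring.
rewrite sin2cos2 => e.
have : (2 * cos a - 1) ^+ 2 * (cos a + 1) = 0 by lra.
move=> /eqP; rewrite mulf_eq0 sqrf_eq0 => /orP[]/eqP; lra.
Qed.

Lemma angle_dist_lt_pithird x : 1 / 2 < cos x -> angle_dist x < pi / 3.
Proof.
have p0 := pi_gt0 R.
have [m xm] := angle_dist_eq x; rewrite -(cosD2pi_int x (- m)).
rewrite rmorphN /= mulNr -cos_norm -xm -cos_pithird ltr_cos //; last first.
  by rewrite in_itv /=; apply/andP; split; lra.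
by rewrite in_itv /= xm normr_ge0 -xm angle_dist_le_pi.
Qed.

(** Seen from the origin, the disc of radius (sqrt 3 / 2) p around p e^(i t) has half-angle pi/3.
    With r = |z|, the law of cosines gives 2 r p cos (arg z - t) > r^2 + p^2 / 4, and the right side
    is at least r p because (r - p/2)^2 >= 0. *)
Lemma angle_dist_arg_lt (arg : R[i] -> R) (z : R[i]) (p t : R) :
  is_principal_arg arg -> 0 < p ->
  (complex.Re z - p * cos t) ^+ 2 + (complex.Im z - p * sin t) ^+ 2 <
    3 / 4 * p ^+ 2 ->
  angle_dist (arg z - t) < pi / 3.
Proof.
move=> argP p0 zp; apply: angle_dist_lt_pithird.
(* [arg 0] is arbitrary, so 0 must be excluded: its distance p from the centre exceeds the
   radius. *)
have z0 : z != 0.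
  apply: contraPneq zp => -> /=; rewrite !sub0r !sqrrN !exprMn -mulrDr cos2Dsin2.
  by apply/negP; rewrite -leNgt mulr1 ler_piMl ?sqr_ge0//; lra.
have [_ _ ez] := argP _ z0.
have r0 : 0 < Normc.normc z.
  by rewrite -ltcR; rewrite -[X in _ < X]/(`|z|) normr_gt0.
move: zp; rewrite {1 2}ez; move: r0 {ez}; set r := Normc.normc z; set a := arg z.
move=> r0; rewrite /expi /= !mul0r subr0 addr0 cosB => zp.
have ca := cos2Dsin2 a; have ct := cos2Dsin2 t.
have e : (r * cos a - p * cos t) ^+ 2 + (r * sin a - p * sin t) ^+ 2 =
  r ^+ 2 * (cos a ^+ 2 + sin a ^+ 2) + p ^+ 2 * (cos t ^+ 2 + sin t ^+ 2)
  - 2 * (r * p) * (cos a * cos t + sin a * sin t) by ring.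
move: zp; rewrite e ca ct.
have h : 0 <= (r - p / 2) ^+ 2 by apply: sqr_ge0.
have rp : 0 < r * p by rewrite mulr_gt0.
move=> zp; rewrite -(ltr_pM2l rp); lra.
Qed.

End Angle.

(** * Expectations in the eigenbasis *)

Section Spectral.
Context {R : realType}.
Implicit Types (x t : R).

Lemma expiD x t : expi (x + t) = expi x * expi t.
Proof.
rewrite /expi cosD sinD; apply/eqP.
by rewrite eq_complex /= addrC (addrC (sin x * _)) !eqxx.
Qed.

Lemma expiX x n : expi x ^+ n = expi (n%:R * x).
Proof.
elim: n => [|n IH]; first by rewrite mul0r /expi cos0 sin0.
by rewrite exprS IH -expiD -natr1 mulrDl mul1r addrC.
Qed.

Lemma norm_expi x : `|expi x| = 1.
Proof. by rewrite normc_def /= cos2Dsin2 sqrtr1. Qed.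

Context {M : nat}.
Implicit Types (u v psi : 'cV[R[i]]_M) (psis : 'I_M -> 'cV[R[i]]_M).

Lemma braketC u v : braket u v = (braket v u)^*%R.
Proof.
rewrite /braket !mxE rmorph_sum; apply: eq_bigr => i _.
by rewrite !mxE rmorphM /= conjCK mulrC.
Qed.

Lemma braket_sumr u (I : finType) (a : I -> R[i]) (v : I -> 'cV[R[i]]_M) :
  braket u (\sum_i a i *: v i) = \sum_i a i * braket u (v i).
Proof.
rewrite /braket mulmx_sumr summxE; apply: eq_bigr => i _.
by rewrite -scalemxAr mxE.
Qed.

(** The matrix Q with columns [psis k] is square, so orthonormality Q^* Q = 1 also yields
    completeness Q Q^* = 1. *)
Lemma orthonormal_expansion psis psi : orthonormal_family psis ->
  psi = \sum_k braket (psis k) psi *: psis k.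
Proof.
move=> on; pose Q := \matrix_(i, k) psis k i 0.
have QQ : (Q ^t*)%sesqui *m Q = 1%:M.
  apply/matrixP => k l; rewrite [RHS]mxE -on /braket !mxE.
  by apply: eq_bigr => i _; rewrite !mxE.
rewrite -{1}[psi]mul1mx -(mulmx1C QQ) -mulmxA; apply/matrixP => i j.
rewrite !mxE summxE ord1; apply: eq_bigr => k _.
rewrite !mxE mulrC; congr (_ * _); rewrite /braket mxE.
by apply: eq_bigr => l _; rewrite !mxE.
Qed.

Lemma eigenvector_expr (U : 'M[R[i]]_M) v a n :
  U *m v = a *: v -> U ^+ n *m v = a ^+ n *: v.
Proof.
move=> Uv; elim: n => [|n IH]; first by rewrite mul1mx scale1r.
by rewrite exprSr -mulmxA Uv -scalemxAr IH scalerA exprS.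
Qed.

Lemma braket_expr_spectral psis (U : 'M[R[i]]_M) (lambda : 'I_M -> R) psi n :
  orthonormal_family psis ->
  (forall k, U *m psis k = expi (lambda k) *: psis k) ->
  braket psi (U ^+ n *m psi) =
    \sum_k `|braket psi (psis k)| ^+ 2 * expi (n%:R * lambda k).
Proof.
move=> on Upsi; rewrite {2}(orthonormal_expansion psi on) mulmx_sumr.
under eq_bigr do
  rewrite -scalemxAr (eigenvector_expr n (Upsi _)) scalerA.
rewrite braket_sumr; apply: eq_bigr => k _.
by rewrite expiX normCK -(braketC (psis k) psi) mulrC mulrA [_ * braket _ psi]mulrC.
Qed.

(** The expectation is an average of unit phases with weights of sum 1; removing the k-th term
    leaves total weight 1 - p. *)
Lemma braket_expr_near psis (U : 'M[R[i]]_M) (lambda : 'I_M -> R) psi n k (p : R) :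
  orthonormal_family psis ->
  (forall k, U *m psis k = expi (lambda k) *: psis k) ->
  braket psi psi = 1 ->
  p = Normc.normc (braket psi (psis k)) ^+ 2 ->
  Normc.normc (braket psi (U ^+ n *m psi) - p%:C * expi (n%:R * lambda k)) <=
    1 - p.
Proof.
move=> on Upsi psi1 pdef.
have pE : p%:C = `|braket psi (psis k)| ^+ 2 by rewrite pdef rmorphXn.
have normC (z : R[i]) : (Normc.normc z)%:C = `|z| by [].
rewrite -lecR normC pE (_ : (1 - p)%:C = 1 - `|braket psi (psis k)| ^+ 2); last first.
  by rewrite rmorphB rmorph1 -pE.
(* The sum of the weights is the spectral formula for the zeroth power of U. *)
have <- : \sum_l `|braket psi (psis l)| ^+ 2 = 1.
  rewrite -psi1 -{3}[psi]mul1mx -[1%:M]/(U ^+ 0).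
  rewrite (braket_expr_spectral _ _ on Upsi).
  by apply: eq_bigr => l _; rewrite mul0r /expi cos0 sin0 mulr1.
rewrite (braket_expr_spectral _ _ on Upsi) (bigD1 k) //= [X in _ <= X - _](bigD1 k) //=.
rewrite ![_ + \sum_(_ | _) _]addrC !addrK.
apply: le_trans (ler_norm_sum _ _ _) _; apply: ler_sum => l _.
by rewrite normrM norm_expi mulr1 normrX normr_id.
Qed.

End Spectral.

(** * Hoeffding's inequality *)

Section BernoulliMgf.
Context {R : realType}.
Implicit Types (f df : R -> R) (p s : R).

Lemma is_derive_ge0 f df :
  (forall x : R, 0 <= x -> is_derive x 1 f (df x)) -> f 0 = 0 ->
  (forall x : R, 0 <= x -> 0 <= df x) -> forall x : R, 0 <= x -> 0 <= f x.
Proof.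
move=> fdf f0 df0 x x0; rewrite -f0.
have fdr y : y \in `[0, x] -> derivable f y 1.
  by rewrite in_itv => /andP[y0 _]; have [] := fdf _ y0.
apply: (@ger0_derive1_ndecr _ f 0 x) => // [y|y|].
- by move=> /subset_itv_oo_cc; exact: fdr.
- rewrite in_itv => /andP[/ltW y0 _].
  by rewrite derive1E; have [_ ->] := fdf _ y0; exact: df0.
- exact: derivable_within_continuous.
Qed.

(** Hoeffding's lemma for a Bernoulli variable. The logarithm [L] of the ratio vanishes to first
    order at 0, and its second derivative is 1/4 - u (1 - u) >= 0 with u = p e^x / D(x). *)
Lemma bernoulli_mgf_le p s : 0 <= p <= 1 -> 0 <= s ->
  1 - p + p * expR s <= expR (p * s + s ^+ 2 / 8).
Proof.
move=> /andP[p0 p1] s0; pose D (x : R) : R := 1 - p + p * expR x.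
have D_gt0 x : 0 < D x.
  have := expR_gt0 x; rewrite /D; have [->|pn1] := eqVneq p 1; first lra.
  move=> e0; have : 0 <= p * expR x by rewrite mulr_ge0 // ltW.
  by have : p < 1 by [rewrite lt_neqAle pn1]; lra.
have dD (x : R) : is_derive x 1 D (p * expR x).
  by apply: is_derive_eq; rewrite /GRing.scale /= ; ring.
pose L (x : R) : R := p * x + x ^+ 2 / 8 - ln (D x).
pose L' (x : R) : R := p + x / 4 - p * expR x / D x.
(* [L] is the logarithm of the ratio of the two sides; [L''] is a square over a square. *)
pose L'' (x : R) : R := (1 - p - p * expR x) ^+ 2 / (4 * D x ^+ 2).
have dL (x : R) : is_derive x 1 L (L' x).
  have dP : is_derive x 1 (fun y : R => p * y + y ^+ 2 / 8) (p + x / 4).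
    by apply: is_derive_eq; rewrite /GRing.scale /=; field.
  have dln := is_derive1_comp (is_derive1_ln (D_gt0 x)) (dD x).
  by apply: (is_derive_eq (is_deriveB dP dln)); rewrite /L' [_^-1 * _]mulrC.
have dL' (x : R) : is_derive x 1 L' (L'' x).
  have dP : is_derive x 1 (fun y : R => p + y / 4) (1 / 4).
    by apply: is_derive_eq; rewrite /GRing.scale /=; field.
  have dE : is_derive x 1 (fun y : R => p * expR y) (p * expR x).
    by apply: is_derive_eq; rewrite /GRing.scale /=; ring.
  have dV := is_deriveV (lt0r_neq0 (D_gt0 x)) (dD x).
  apply: (is_derive_eq (is_deriveB dP (is_deriveM dE dV))).
  rewrite /L'' /GRing.scale /=; have := lt0r_neq0 (D_gt0 x); rewrite /D => Dn0.
  by field.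
have L'_ge0 : forall x : R, 0 <= x -> 0 <= L' x.
  apply: (is_derive_ge0 (df := L'')) => // [|x _].
    by rewrite /L' /D expR0 mulr1 subrK divr1 mul0r addr0 subrr.
  by rewrite divr_ge0 ?sqr_ge0 // mulr_ge0 // sqr_ge0.
have : 0 <= L s.
  apply: (is_derive_ge0 (df := L')) => //.
  by rewrite /L /D expR0 mulr1 subrK ln1 mulr0 expr0n mul0r addr0 subrr.
by rewrite subr_ge0 -ler_expR lnK // posrE.
Qed.

End BernoulliMgf.

Lemma measurable_superlevel d (T : measurableType d) (R : realType)
    (f : T -> R) (a : R) :
  measurable_fun setT f -> measurable [set w | a <= f w].
Proof.
move=> mf; rewrite (_ : [set w | _] = setT `&` f @^-1` `[a, +oo[%classic).
  exact: mf.
by rewrite setTI; apply/seteqP; split=> w; rewrite /= in_itv /= andbT.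
Qed.

Section Hoeffding.
Context d (T : measurableType d) (R : realType) (P : probability T R).
Context (n : nat) (A : 'I_n -> set T) (mA : forall i, measurable (A i)).
Context (indepA : forall S : {set 'I_n},
  P (\bigcap_(i in [set` S]) A i) = (\prod_(i in S) P (A i))%E).

Let bigcap_measurable (S : {set 'I_n}) : measurable (\bigcap_(i in [set` S]) A i).
Proof. by apply: fin_bigcap_measurable => // i _; exact: mA. Qed.

(** Each factor is e^(s 1_A) = 1 + (e^s - 1) 1_A. Expanding the product over subsets leaves only
    indicators of intersections, whose probabilities are what independence provides. *)
Lemma expR_sum_indicE (s : R) w :
  expR (s * \sum_i \1_(A i) w) =
  \sum_(S : {set 'I_n}) (expR s - 1) ^+ #|S| * \1_(\bigcap_(i in [set` S]) A i) w.
Proof.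
rewrite mulr_sumr expR_sum.
have -> : \prod_i expR (s * \1_(A i) w) =
    \prod_i ((expR s - 1) * \1_(A i) w + 1).
  apply: eq_bigr => i _; rewrite indicE.
  by case: (w \in A i); rewrite /= ?mulr1 ?subrK ?mulr0 ?expR0 ?add0r.
rewrite bigA_distr; apply: eq_bigr => S _.
rewrite -big_mkcond /= big_split /= prodr_const; congr (_ * _).
rewrite indicE; case: (boolP (w \in _)) => [|/negP] wS.
  apply: big1 => i iS; rewrite indicE mem_set //.
  by move: wS; rewrite inE => /(_ i iS).
apply/eqP; rewrite prodf_seq_eq0; apply/hasP.
apply: contrapT => nex; apply: wS; rewrite inE => i /= iS.
apply: contrapT => nAi; apply: nex; exists i; first exact: mem_index_enum.
by rewrite iS indicE memNset //= eqxx.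
Qed.

(** Independence factors each term of the expansion, and the sum over subsets folds back into a
    product. As s >= 0, all coefficients are nonnegative and the integral is taken termwise. *)
Lemma integral_expR_sum_indic (s : R) : 0 <= s ->
  (\int[P]_w (expR (s * \sum_i \1_(A i) w))%:E =
   (\prod_i (1 - fine (P (A i)) + fine (P (A i)) * expR s))%:E)%E.
Proof.
move=> s0.
have es0 : 0 <= expR s - 1 by rewrite subr_ge0 -expR0 ler_expR.
under eq_integral do rewrite expR_sum_indicE -sumEFin.
have mI (S : {set 'I_n}) : measurable_fun setT
    (fun w : T => (\1_(\bigcap_(i in [set` S]) A i) w)%:E : \bar R).
  by apply/measurable_EFinP; exact: measurable_indic.
rewrite ge0_integral_sum //; first last.
- by move=> S w _; rewrite lee_fin mulr_ge0 ?exprn_ge0.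
- move=> S; under eq_fun do rewrite EFinM.
  exact: measurable_funeM.
have -> : \prod_i (1 - fine (P (A i)) + fine (P (A i)) * expR s) =
    \prod_i ((expR s - 1) * fine (P (A i)) + 1).
  by apply: eq_bigr => i _; ring.
rewrite bigA_distr -sumEFin; apply: eq_bigr => S _.
under eq_integral do rewrite EFinM.
rewrite ge0_integralZl_EFin //; last exact: exprn_ge0.
rewrite integral_indic // setIT.
rewrite [X in (_ * X)%E = _](indepA S).
rewrite -big_mkcond /= big_split /= prodr_const EFinM; congr (_ * _)%E.
rewrite -prodEFin; apply: eq_bigr => i _; rewrite fineK //.
exact: fin_num_measure.
Qed.

Lemma hoeffding_le (a : R) : 0 <= a ->
  (P [set w | a <= \sum_i (\1_(A i) w - fine (P (A i)))]%R <=
   (expR (- (2 * a ^+ 2 / n%:R)))%:E)%E.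
Proof.
move=> a0; set E := [set w | _].
pose q : R := \sum_i fine (P (A i)).
have p01 i : 0 <= fine (P (A i)) <= 1.
  by rewrite fine_ge0 ?measure_ge0 //= -lee_fin fineK ?fin_num_measure ?probability_le1.
have ES w : E w -> a + q <= \sum_i \1_(A i) w.
  by rewrite /E /= sumrB lerBrDr.
have mE : measurable E.
  by apply: measurable_superlevel; apply: measurable_sum => i; apply: measurable_funB.
(* For n = 0 the quotient by n is 0 by convention, so the bound is 1. *)
case: (posnP n) => [n0|n_gt0].
  by rewrite n0 invr0 mulr0 oppr0 expR0 probability_le1.
(* This s minimizes the Chernoff exponent - s a + n s^2 / 8, with minimum - 2 a^2 / n. *)
pose s := 4 * a / n%:R.
have s0 : 0 <= s by rewrite divr_ge0 // mulr_ge0.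
(* Markov's inequality for the exponential of s times the sum, then [bernoulli_mgf_le] on each
   factor. *)
have : ((expR (s * (a + q)))%:E * P E <= (expR (s * q + n%:R * (s ^+ 2 / 8)))%:E)%E.
  apply: (@le_trans _ _ (\int[P]_w (expR (s * \sum_i \1_(A i) w))%:E)%E).
    rewrite -(setIT E) -integral_indic // -ge0_integralZl_EFin ?expR_ge0 //; last first.
      by apply/measurable_EFinP; exact: measurable_indic.
    apply: ge0_le_integral => //.
    - by apply: measurable_funeM; apply/measurable_EFinP; exact: measurable_indic.
    - apply/measurable_EFinP; apply: measurableT_comp => //.
      by apply: measurable_funM => //; apply: measurable_sum => i;
        exact: measurable_indic.
    - move=> w _; rewrite -EFinM lee_fin indicE.
      have [/set_mem Ew|_] := boolP (w \in E); last by rewrite mulr0 expR_ge0.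
      by rewrite mulr1 ler_expR ler_wpM2l // ES.
  rewrite integral_expR_sum_indic // lee_fin.
  have -> : s * q + n%:R * (s ^+ 2 / 8) =
      \sum_(i < n) (fine (P (A i)) * s + s ^+ 2 / 8).
    by rewrite big_split /= -mulr_suml sumr_const card_ord mulr_natl mulrC.
  rewrite expR_sum; apply: ler_prod => i _; rewrite bernoulli_mgf_le // andbT.
  have /andP[p0 p1] := p01 i.
  by rewrite addr_ge0 ?subr_ge0 // mulr_ge0 ?expR_ge0.
rewrite muleC -lee_pdivlMr ?expR_gt0 // => /le_trans; apply.
rewrite -EFinM lee_fin -expRN -expRD ler_expR.
rewrite le_eqVlt; apply/orP; left; apply/eqP.
have n0 : n%:R != 0 :> R by rewrite pnatr_eq0 -lt0n.
by rewrite /s; field.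
Qed.
End Hoeffding.

Lemma measure_bigsetU_le d (T : measurableType d) (R : realType)
    (mu : measure T R) (I : Type) (s : seq I) (B : I -> set T) :
  (forall i, measurable (B i)) ->
  measurable (\big[setU/set0]_(i <- s) B i) /\
  (mu (\big[setU/set0]_(i <- s) B i) <= \sum_(i <- s) mu (B i))%E.
Proof.
move=> mB; elim: s => [|i s [mU IH]]; first by rewrite !big_nil measure0.
rewrite !big_cons; split; first exact: measurableU.
by apply: le_trans (leeD2l _ IH); exact: measureU2.
Qed.

(** * Tail bounds for averages of independent signs *)

Section SignAverage.
Context d (T : measurableType d) (R : realType) (P : probability T R).

(** The mean is P (X = 1) - P (X = -1), and these probabilities add up to 1. The sign (-1)^b lets
    one statement serve both tails. *)
Lemma sign_expectation (X : {RV P >-> R}) (m : R) (b : bool) :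
  (forall w, X w = 1 \/ X w = -1) -> 'E_P[X]%E = m%:E ->
  P (X @^-1` [set (-1) ^+ b]) = ((1 + (-1) ^+ b * m) / 2)%:E.
Proof.
move=> X1 EX; set A := X @^-1` [set 1]; set B := X @^-1` [set -1].
have mA : measurable A by exact: measurable_funPTI.
have mB : measurable B by exact: measurable_funPTI.
have n11 : (1 : R) <> -1 by lra.
have AB : B = ~` A.
  apply/seteqP; split=> w; rewrite /A /B /=; first by move=> -> /esym.
  by case: (X1 w).
have PB : P B = (1 - P A)%E by rewrite AB probability_setC.
have : (m%:E = P A - P B)%E.
  rewrite -EX expectation_def.
  under eq_integral => w _.
    rewrite (_ : (X w)%:E = (\1_A w)%:E - (\1_B w)%:E)%E; last first.
      rewrite !indicE /A /B -EFinB; congr EFin.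
      case: (X1 w) => Xw.
        by rewrite mem_set // memNset ?subr0 //= Xw.
      by rewrite memNset ?mem_set ?sub0r //= Xw; exact: nesym.
    over.
  rewrite integralB_EFin //; try exact: integrable_indic.
  by rewrite !integral_indic // !setIT.
rewrite PB -(fineK (fin_num_measure P _ mA)) -!EFinB => -[mE].
case: b; first rewrite -/B PB -(fineK (fin_num_measure P _ mA)) -EFinB.
  by congr EFin; rewrite mE; field.
by rewrite expr0 -/A -(fineK (fin_num_measure P _ mA)); congr EFin; rewrite mE; field.
Qed.

Context (I : finType) (X : I -> {RV P >-> R}) (n : nat) (f : 'I_n -> I) (m : R).
Context (X1 : forall i w, X i w = 1 \/ X i w = -1).
Context (Xindep : mutually_independent X) (finj : injective f).
Context (EX : forall k, 'E_P[X (f k)]%E = m%:E).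

Let average w : R := (\sum_k X (f k) w) / n%:R.

Lemma measurable_average : measurable_fun setT average.
Proof.
apply: measurable_funM => //; apply: measurable_sum => k.
exact: measurable_funP.
Qed.

(* [(-1) ^+ b * X] is [2 * 1_A - 1] for [A] the event [X = (-1) ^+ b]. *)
Lemma sign_average_tail (b : bool) (t : R) : (0 < n)%N -> 0 <= t ->
  (P [set w | t <= (-1) ^+ b * (average w - m)]%R <=
   (expR (- (n%:R * t ^+ 2 / 2)))%:E)%E.
Proof.
move=> n_gt0 t0; pose A k := X (f k) @^-1` [set (-1) ^+ b].
have mA k : measurable (A k) by exact: measurable_funPTI.
have PA k : P (A k) = ((1 + (-1) ^+ b * m) / 2)%:E by exact: sign_expectation.
have indepA (S : {set 'I_n}) :
    P (\bigcap_(i in [set` S]) A i) = (\prod_(i in S) P (A i))%E.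
  (* Independence of the whole family passes to the repetitions along the injection [f]. *)
  have := Xindep (f @: S) (B := fun=> [set (-1) ^+ b]).
  rewrite big_imset /=; last by move=> ? ? _ _; exact: finj.
  move=> <-; last by move=> _; exact: measurable_set1.
  congr (P _); apply/seteqP; split=> w Aw.
    by move=> i /= /imsetP[k kS ->]; exact: Aw.
  by move=> k /= kS; apply: Aw => /=; exact: imset_f.
have n0 : n%:R != 0 :> R by rewrite pnatr_eq0 -lt0n.
have := hoeffding_le mA indepA (a := n%:R * t / 2).
have -> : 2 * (n%:R * t / 2) ^+ 2 / n%:R = n%:R * t ^+ 2 / 2 by field.
rewrite divr_ge0 ?mulr_ge0 // => /(_ isT); apply: le_trans.
rewrite le_eqVlt; apply/orP; left; apply/eqP; congr (P _); apply/seteqP.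
have E w : \sum_k (\1_(A k) w - fine (P (A k))) =
    n%:R / 2 * ((-1) ^+ b * (average w - m)).
  have indA k : \1_(A k) w = (1 + (-1) ^+ b * X (f k) w) / 2.
    rewrite indicE /A.
    case: (X1 (f k) w) => e; case: (b); rewrite e ?expr1 ?expr0.
    - by rewrite memNset /= ?e; [field|lra].
    - by rewrite mem_set /= ?e; [field|].
    - by rewrite mem_set /= ?e; [field|].
    - by rewrite memNset /= ?e; [field|lra].
  transitivity (\sum_(k < n) ((-1) ^+ b / 2 * X (f k) w - (-1) ^+ b * m / 2)).
    by apply: eq_bigr => k _; rewrite indA PA /=; field.
  rewrite big_split /= -mulr_sumr sumr_const card_ord -mulr_natl /average.
  by field.
have n2 : 0 < n%:R / 2 :> R by rewrite divr_gt0 // ltr0n.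
by split=> w /=; rewrite E [_ * t / 2]mulrAC ler_pM2l.
Qed.

Lemma norm_sign_average_tail (t : R) : (0 < n)%N -> 0 <= t ->
  (P [set w | t <= `|average w - m|]%R <=
   (2 * expR (- (n%:R * t ^+ 2 / 2)))%:E)%E.
Proof.
move=> n_gt0 t0; pose B (b : bool) := [set w | t <= (-1) ^+ b * (average w - m)].
have mB b : measurable (B b).
  apply: measurable_superlevel; apply: measurable_funM => //.
  by apply: measurable_funB => //; exact: measurable_average.
rewrite (_ : [set w | _] = B false `|` B true); last first.
  apply/seteqP; split=> w; rewrite /B /= expr0 expr1 mul1r mulN1r; last first.
    by rewrite ler_normr => -[->|->]; rewrite ?orbT.
  by rewrite ler_normr => /orP[]; [left|right].
apply: le_trans; first by apply: measureU2; exact: mB.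
by rewrite mulr_natl EFinD leeD ?sign_average_tail.
Qed.

End SignAverage.

(** * Refinement of the phase estimate *)

Section Update.
Context {R : realType}.
Implicit Types (x y l t c : R) (z : R[i]) (j : nat).

Lemma angle_distD x y : angle_dist (x + y) <= angle_dist x + angle_dist y.
Proof.
have [m ->] := angle_dist_eq x; have [n ->] := angle_dist_eq y.
apply: le_trans (angle_dist_le _ (m + n)) _; apply: le_trans (ler_normD _ _).
by rewrite intrD le_eqVlt; apply/orP; left; apply/eqP; congr `|_|; ring.
Qed.

Lemma angle_distN x : angle_dist (- x) = angle_dist x.
Proof.
suff le y : angle_dist (- y) <= angle_dist y.
  by apply/le_anti; rewrite le -{1}[x]opprK le.
have [m ->] := angle_dist_eq y; apply: le_trans (angle_dist_le _ (- m)) _.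
by rewrite -normrN rmorphN /= le_eqVlt; apply/orP; left; apply/eqP; congr `|_|; ring.
Qed.

(** Dividing by 2^j shrinks the error but leaves the branch m to be matched. Write - m = q 2^j + k
    with 0 <= k < 2^j: k selects the candidate, and q amounts to whole turns. *)
Lemma rpe_candidates_near (arg : R[i] -> R) z j l c :
  angle_dist (arg z - 2 ^+ j * l) < c ->
  exists2 t, rpe_candidates arg z j t & angle_dist (t - l) < c / 2 ^+ j.
Proof.
have j0 : 0 < 2 ^+ j :> R by rewrite exprn_gt0.
move=> /angle_dist_ltP[m am].
pose N : int := (2 ^ j)%N; have N0 : N != 0 by rewrite /N eqz_nat expn_eq0.
pose k := `|((- m) %% N)%Z|%N; pose q := ((- m) %/ N)%Z.
have kE : k%:Z = ((- m) %% N)%Z by rewrite /k gez0_abs // modz_ge0.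
have mE : (m%:~R : R) = - (q%:~R * 2 ^+ j + k%:R).
  rewrite -[m]opprK [in LHS](divz_eq (- m) N) -kE -/q rmorphN /= rmorphD rmorphM /=.
  by rewrite /N -!pmulrn natrX.
exists ((2 * k%:R * pi + arg z) / 2 ^+ j).
  exists k => //; rewrite -ltz_nat kE; have := ltz_pmod (- m) (d := N).
  by apply; rewrite /N ltz_nat expn_gt0.
apply/angle_dist_ltP; exists (- q).
rewrite ltr_pdivlMr // -[X in _ * X]ger0_norm ?ltW // -normrM.
rewrite (_ : (_ - _) * 2 ^+ j = arg z - 2 ^+ j * l - m%:~R * (2 * pi)) //.
by rewrite mE rmorphN /=; field; rewrite lt0r_neq0.
Qed.

(* Candidates differ by multiples of [2 * pi / 2 ^+ j], so a candidate whose error is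
   less than [2 * pi / 2 ^+ j] away from that of the best one is the best one. *)
Lemma rpe_candidates_refine (arg : R[i] -> R) z j l t :
  angle_dist (arg z - 2 ^+ j * l) < pi / 3 ->
  rpe_candidates arg z j t -> angle_dist (t - l) < 5 * pi / 3 / 2 ^+ j ->
  angle_dist (t - l) < pi / 3 / 2 ^+ j.
Proof.
have p0 := pi_gt0 R; have j0 : 0 < 2 ^+ j :> R by rewrite exprn_gt0.
move=> /angle_dist_ltP[m am] [k _ tE] /angle_dist_ltP[n tn].
apply/angle_dist_ltP; exists n; move: tn.
have nM y : `|y| * 2 ^+ j = `|y * 2 ^+ j| by rewrite normrM (ger0_norm (ltW j0)).
rewrite !(ltr_pdivlMr _ _ j0) !nM => tn.
suff -> : (t - l - n%:~R * (2 * pi)) * 2 ^+ j =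
    arg z - 2 ^+ j * l - m%:~R * (2 * pi) by [].
pose r : int := k%:Z + m - n * (2 ^ j)%N%:Z.
have E : (t - l - n%:~R * (2 * pi)) * 2 ^+ j =
    arg z - 2 ^+ j * l - m%:~R * (2 * pi) + r%:~R * (2 * pi).
  rewrite /r rmorphB rmorphD rmorphM /= -!pmulrn natrX tE; field.
  by rewrite lt0r_neq0.
(* The two scaled errors are below 5 pi / 3 and pi / 3 and differ by 2 pi r, so |r| < 1. *)
suff r0 : r = 0 by rewrite E r0 mul0r addr0.
apply/eqP; rewrite -absz_eq0 -leqn0 -ltnS -ltz_nat -(ltr_int R) abszE intr_norm.
have : `|r%:~R * (2 * pi)| < 2 * pi :> R.
  move: tn am; rewrite E !ltr_norml.
  by move: (_ - _) (r%:~R * _) => u v /andP[? ?] /andP[? ?]; apply/andP; split; lra.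
by rewrite normrM [X in _ * X]ger0_norm ?mulr_ge0 ?ltW // gtr_pMl ?mulr_gt0.
Qed.

(** The deterministic part of the argument, to be applied to each outcome for which all the averages
    are accurate. *)
Lemma rpe_nearest_candidates_near (arg : R[i] -> R) (J : nat) (z : nat -> R[i])
    (theta : nat -> R) l :
  (forall j, (j <= J)%N -> angle_dist (arg (z j) - 2 ^+ j * l) < pi / 3) ->
  (forall j, (j <= J)%N ->
    let prev := if j is i.+1 then theta i else 0 in
    rpe_candidates arg (z j) j (theta j) /\
    forall t, rpe_candidates arg (z j) j t ->
      angle_dist (theta j - prev) <= angle_dist (t - prev)) ->
  forall j, (j <= J)%N -> angle_dist (theta j - l) < pi / 3 / 2 ^+ j.
Proof.
move=> argz thetaP; elim=> [|j IH] jJ.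
  have [[k k0 ->] _] := thetaP _ jJ; move: k0; rewrite expn0 ltnS leqn0 => /eqP ->.
  have := argz _ jJ; rewrite !expr0 !divr1 mul1r => h.
  by rewrite mulr0 mul0r add0r.
have {}IH := IH (ltnW jJ).
have [Stheta thetamin] := thetaP _ jJ.
apply: rpe_candidates_refine (argz _ jJ) Stheta _.
have [t St tl] := rpe_candidates_near (argz _ jJ).
have := thetamin _ St => /= tmin.
(* In units of pi / (3 * 2^(j+1)): [theta j] is within 2 of l and the candidate t within 1, so t is
   within 3 of [theta j]. By minimality so is [theta j.+1], which is then within 5 of l. *)
have h1 := angle_distD (theta j.+1 - theta j) (theta j - l).
have h2 := angle_distD (t - l) (- (theta j - l)).
rewrite angle_distN in h2.
rewrite addrA subrK in h1.
rewrite opprB addrA subrK in h2.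
have e : pi / 3 / 2 ^+ j = 2 * (pi / 3 / 2 ^+ j.+1) :> R.
  by rewrite exprS; field; rewrite expf_neq0.
have e' : 5 * pi / 3 / 2 ^+ j.+1 = 5 * (pi / 3 / 2 ^+ j.+1) :> R.
  by rewrite !mulrA.
rewrite e in IH; rewrite e'; lra.
Qed.

End Update.

(** * From accurate averages to accurate arguments *)

Section GoodEvent.
Context {R : realType}.

Lemma normc_ge0 (z : R[i]) : 0 <= Normc.normc z.
Proof. by case: z => a b; exact: sqrtr_ge0. Qed.

Lemma sqr_normc (z : R[i]) :
  Normc.normc z ^+ 2 = complex.Re z ^+ 2 + complex.Im z ^+ 2.
Proof. by case: z => a b; rewrite sqr_sqrtr // addr_ge0 ?sqr_ge0. Qed.

Lemma rpe_arg_near (arg : R[i] -> R) (z z0 : R[i]) (p phi t : R) :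
  is_principal_arg arg -> 0 < p ->
  Normc.normc (z0 - p%:C * expi phi) <= 1 - p ->
  0 < rpe_alpha (1 - p) -> 2 * t ^+ 2 = rpe_alpha (1 - p) ^+ 2 ->
  `|complex.Re z - complex.Re z0| < t -> `|complex.Im z - complex.Im z0| < t ->
  angle_dist (arg z - phi) < pi / 3.
Proof.
move=> argP p0 z0p al0 tal zx zy; apply: (angle_dist_arg_lt argP p0).
have zz0 : Normc.normc (z - z0) < rpe_alpha (1 - p).
  have : Normc.normc (z - z0) ^+ 2 < rpe_alpha (1 - p) ^+ 2.
    rewrite -tal mulr_natl mulr2n.
    have -> : Normc.normc (z - z0) ^+ 2 =
        `|complex.Re z - complex.Re z0| ^+ 2 + `|complex.Im z - complex.Im z0| ^+ 2.
      by rewrite sqr_normc !raddfB !real_normK ?num_real.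
    by rewrite ltrD // ltr_pXn2r ?nnegrE //; apply: ltW; apply: le_lt_trans zx.
  by rewrite ltr_pXn2r ?nnegrE ?normc_ge0 // ltW.
have : Normc.normc (z - p%:C * expi phi) < Num.sqrt 3 / 2 * p.
  rewrite -(subrK z0 z) -addrA; apply: le_lt_trans (le_normcD _ _) _.
  by move: zz0; rewrite /rpe_alpha; lra.
rewrite -(ltr_pXn2r (n := 2)) ?nnegrE //; last 2 first.
- exact: normc_ge0.
- by rewrite !mulr_ge0 ?sqrtr_ge0 // ltW.
have -> : (Num.sqrt 3 / 2 * p) ^+ 2 = 3 / 4 * p ^+ 2 :> R.
  by rewrite !exprMn sqr_sqrtr //; field.
by rewrite sqr_normc; case: (z) => a b; rewrite /= !mul0r subr0 addr0.
Qed.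
End GoodEvent.

(** * Success probability *)

Section RunCounts.
Context {R : realType}.
Implicit Types (x delta eps eta : R).

(** For negative x too, since the absolute value in [nceil] can only raise the ceiling. *)
Lemma nceil_ge x : x <= (nceil x)%:R.
Proof.
apply: le_trans (ceil_ge x) _; rewrite /nceil natr_absz; apply: le_trans (ler_norm _) _.
by rewrite intr_norm.
Qed.

Lemma nceil_lt x : 0 <= x -> (nceil x)%:R < x + 1.
Proof.
move=> x0; have : -1 < x by lra.
rewrite /nceil natr_absz -ceil_ge0 => /ger0_norm ->.
by have := ceilB1_lt x; rewrite rmorphB /= ltrBlDr.
Qed.

Lemma rpe_alpha_gt0 delta : delta < 2 * Num.sqrt 3 - 3 -> 0 < rpe_alpha delta.
Proof.
rewrite /rpe_alpha; have : Num.sqrt 3 ^+ 2 = 3 :> R by rewrite sqr_sqrtr.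
have : 0 <= Num.sqrt 3 :> R by exact: sqrtr_ge0.
move: (Num.sqrt 3) => s s0 s3 ds.
(* As s^2 = 3, this product equals [rpe_alpha delta]; hence the threshold 2 sqrt 3 - 3. *)
have : 0 < (2 * s - 3 - delta) * (1 + s / 2).
  by rewrite mulr_gt0 ?subr_gt0 // ltr_wpDr ?divr_ge0.
move: s3; rewrite expr2; lra.
Qed.

Lemma rpe_alpha_lt x y : x < y -> rpe_alpha y < rpe_alpha x :> R.
Proof.
move=> xy; have : 0 <= Num.sqrt 3 :> R by exact: sqrtr_ge0.
rewrite /rpe_alpha; move: (Num.sqrt 3) => s s0.
have : 0 <= (y - x) * s by rewrite mulr_ge0 // subr_ge0 ltW.
lra.
Qed.

Lemma exp2_rpe_J_ge eps : 0 < eps -> eps^-1 <= 2 ^+ rpe_J eps.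
Proof.
move=> e0; have ei0 : 0 < eps^-1 by rewrite invr_gt0.
rewrite -ler_ln ?posrE ?exprn_gt0 // lnXn // -[ln 2 *+ _]mulr_natl.
rewrite -ler_pdivrMr ?ln_gt0 ?ltr1n //.
exact: nceil_ge.
Qed.

Lemma exp2_rpe_J_le eps : 0 < eps < 1 -> 2 ^+ rpe_J eps <= 2 * eps^-1.
Proof.
move=> /andP[e0 e1]; have ei0 : 0 < eps^-1 by rewrite invr_gt0.
have l2 : 0 < ln 2 :> R by rewrite ln_gt0 // ltr1n.
rewrite -ler_ln ?posrE ?exprn_gt0 ?mulr_gt0 // lnXn // lnM ?posrE //.
rewrite -[ln 2 *+ _]mulr_natl -ler_pdivlMr // mulrDl divff ?lt0r_neq0 // addrC.
apply/ltW/nceil_lt/divr_ge0; last exact: ltW.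
by rewrite ln_ge0 // invf_ge1 // ltW.
Qed.

Lemma rpe_half_Ns delta eps eta : (rpe_Ns delta eps eta)./2 =
  nceil (4 / rpe_alpha delta ^+ 2 * (ln (4 / eta) + ln ((rpe_J eps)%:R + 1))).
Proof. by rewrite /rpe_Ns mul2n doubleK. Qed.

Lemma rpe_repetitions_gt0 delta eps eta :
  0 < rpe_alpha delta -> 0 < eta < 1 -> (0 < (rpe_Ns delta eps eta)./2)%N.
Proof.
move=> a0 /andP[e0 e1]; rewrite -(ltr0n R) rpe_half_Ns.
apply: lt_le_trans (nceil_ge _).
rewrite mulr_gt0 ?divr_gt0 ?exprn_gt0 // ltr_pwDl //.
  by rewrite ln_gt0 // ltr_pdivlMr // mul1r; lra.
by rewrite ln_ge0 // lerDr.
Qed.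

(* The strictness, inherited from that of [rpe_alpha delta < a], is what makes the
   final probability bound strict. *)
Lemma rpe_failure_lt delta eps eta a :
  0 < rpe_alpha delta -> rpe_alpha delta < a -> 0 < eta < 1 ->
  4 * ((rpe_J eps)%:R + 1) *
    expR (- ((rpe_Ns delta eps eta)./2%:R * a ^+ 2 / 4)) < eta.
Proof.
move=> al0 ala /[dup] eta01 /andP[e0 e1].
have n0 := rpe_repetitions_gt0 eps al0 eta01.
set n := (_./2)%:R; set K := (rpe_J eps)%:R + 1.
have K0 : 0 < K :> R by rewrite ltr_wpDl.
have e4 : 0 < 4 / eta by rewrite divr_gt0.
(* It remains to compare exponents: ln (4 / eta) + ln K < n a^2 / 4. *)
have -> : 4 * K = eta * expR (ln (4 / eta) + ln K).
  by rewrite expRD !lnK ?posrE //; field; rewrite lt0r_neq0.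
rewrite -mulrA -expRD gtr_pMr // -[X in _ < X]expR0 ltr_expR subr_lt0.
apply: (@le_lt_trans _ _ (n * rpe_alpha delta ^+ 2 / 4)).
  have := nceil_ge (4 / rpe_alpha delta ^+ 2 * (ln (4 / eta) + ln K)).
  rewrite -rpe_half_Ns -/n mulrAC ler_pdivrMr ?exprn_gt0 // => h.
  by rewrite ler_pdivlMr // mulrC.
by rewrite ltr_pM2r // ltr_pM2l ?ltr0n // ltr_pXn2r // nnegrE ltW // (lt_trans al0).
Qed.

End RunCounts.

Lemma rpe_correct (R : realType) (delta : R) (M : nat)
    (U : 'M[R[i]]_M) (psis : 'I_M -> 'cV[R[i]]_M) (lambda : 'I_M -> R)
    (psi : 'cV[R[i]]_M) (eps eta : R) (k : 'I_M)
    (d : measure_display) (T : measurableType d) (P : probability T R)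
    (arg : R[i] -> R)
    (X : rpe_run (rpe_J eps) (rpe_Ns delta eps eta) -> {RV P >-> R})
    (theta : nat -> {RV P >-> R}) :
  delta < 2 * Num.sqrt 3 - 3 ->
  orthonormal_family psis ->
  (forall k, U *m psis k = expi (lambda k) *: psis k) ->
  braket psi psi = 1 ->
  0 < eps -> 0 < eta < 1 ->
  1 - delta < Normc.normc (braket psi (psis k)) ^+ 2 ->
  is_principal_arg arg -> hadamard_tests U psi X -> rpe_output arg X theta ->
  ((1 - eta)%:E <
    P [set w | angle_dist (theta (rpe_J eps) w - lambda k) < pi / 3 * eps]%R)%E.
Proof.
move=> hdelta on Upsi psi1 eps0 eta01; set p := _ ^+ 2 => hp argP [X1 EX indepX] thetaP.
set J := rpe_J eps in X X1 EX indepX thetaP *.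
set Ns := rpe_Ns delta eps eta in X X1 EX indepX thetaP *.
have al0 := rpe_alpha_gt0 hdelta.
have ala : rpe_alpha delta < rpe_alpha (1 - p) by apply: rpe_alpha_lt; lra.
have n_gt0 : (0 < Ns./2)%N by exact: rpe_repetitions_gt0.
set a := rpe_alpha (1 - p) in ala; have a0 : 0 < a by exact: lt_trans ala.
(* Here p > 1 - delta > 4 - 2 sqrt 3, which is positive because sqrt 3 < 2. *)
have p0 : 0 < p.
  have : 0 <= Num.sqrt 3 :> R by exact: sqrtr_ge0.
  have : Num.sqrt 3 ^+ 2 = 3 :> R by rewrite sqr_sqrtr.
  move: (Num.sqrt 3) hdelta => s ds s3 s0; have : s < 2.
    by rewrite -(ltr_pXn2r (n := 2)) ?nnegrE // s3; lra.
  by move=> ?; lra.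
pose z (j : 'I_J.+1) := braket psi (U ^+ (2 ^ j) *m psi).
pose mu (r : 'I_J.+1 * bool) := if r.2 then complex.Im (z r.1) else complex.Re (z r.1).
pose avg (r : 'I_J.+1 * bool) w := (\sum_(n < Ns./2) X (r.1, r.2, n) w) / (Ns./2)%:R.
pose t := a / Num.sqrt 2.
have t0 : 0 <= t by rewrite divr_ge0 ?sqrtr_ge0 // ltW.
have t2 : 2 * t ^+ 2 = a ^+ 2 by rewrite exprMn exprVn sqr_sqrtr // mulrC divfK.
pose bad r := [set w | t <= `|avg r w - mu r|].
have finj (r : 'I_J.+1 * bool) : injective (fun n : 'I_(Ns./2) => (r.1, r.2, n)).
  by move=> n n' [].
have mbad r : measurable (bad r).
  apply: measurable_superlevel; apply: measurableT_comp => //.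
  by apply: measurable_funB => //; exact: measurable_average.
have Pbad r : (P (bad r) <= (2 * expR (- (Ns./2%:R * a ^+ 2 / 4)))%:E)%E.
  have -> : Ns./2%:R * a ^+ 2 / 4 = Ns./2%:R * t ^+ 2 / 2 by rewrite -t2; field.
  by apply: (norm_sign_average_tail X1 indepX (finj r)) => //.
have [mU PU] := measure_bigsetU_le P (index_enum _) mbad.
set B := \big[setU/set0]_(r <- _) bad r in mU PU.
have PB : (P B < eta%:E)%E.
  apply: le_lt_trans PU _; apply: le_lt_trans.
    by apply: lee_sum => r _; exact: Pbad.
  (* There are 2 (J + 1) averages, each with two tails, which accounts for the factor 4 (J + 1). *)
  rewrite sumEFin lte_fin sumr_const card_prod card_bool card_ord.
  apply: le_lt_trans (rpe_failure_lt eps al0 ala eta01).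
  rewrite -/J -/Ns; move: (expR _) => e; rewrite -[_ *+ (_ * _)]mulr_natl natrM -natr1.
  by rewrite le_eqVlt; apply/orP; left; apply/eqP; ring.
set G := [set w | _].
have mG : measurable G.
  have := @measurable_angle_dist_lt R (lambda k) (pi / 3 * eps).
  exact: measurable_funPTI.
(* Off the bad events the deterministic refinement applies up to j = J, and 2^J >= 1/eps turns its
   bound into (pi / 3) eps. *)
have BG : ~` B `<=` G.
  move=> w nB; rewrite /G /=.
  have good r : `|avg r w - mu r| < t.
    rewrite ltNge; apply/negP => wr; apply: nB; rewrite /B.
    by rewrite (bigD1_seq r) ?mem_index_enum ?index_enum_uniq //; left.
  have argz j : (j <= J)%N ->
      angle_dist (arg (rpe_Z X (inord j) w) - 2 ^+ j * lambda k) < pi / 3.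
    move=> jJ.
    apply: (@rpe_arg_near _ _ _ (z (inord j)) p _ t) => //.
    - have := braket_expr_near (2 ^ j) on Upsi psi1 (erefl p).
      by rewrite /z inordK ?ltnS // natrX.
    - exact: (good (inord j, false)).
    - exact: (good (inord j, true)).
  have := rpe_nearest_candidates_near argz (theta := theta ^~ w).
  move=> /(_ _ J (leqnn J)) h; apply: lt_le_trans (h _) _ => [j jJ|].
    have := thetaP (inord j) w; rewrite inordK ?ltnS //.
  rewrite ler_pM2l ?divr_gt0 ?pi_gt0 // -[eps]invrK.
  rewrite lef_pV2 ?posrE ?exprn_gt0 ?invr_gt0 //.
  exact: exp2_rpe_J_ge.
apply: (@lt_le_trans _ _ (P (~` B))); last first.
  by apply: le_measure => //; rewrite inE //; exact: measurableC.
move: PB; rewrite probability_setC // -(fineK (fin_num_measure P _ mU)) -EFinB !lte_fin.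
by lra.
Qed.

(** * Cost *)

Section Cost.
Context {R : realType}.

Lemma T_max_le J Ns : (T_max J Ns <= 2 ^ J)%N.
Proof.
by apply/bigmax_leqP => r _; rewrite /run_depth leq_exp2l // -ltnS ltn_ord.
Qed.

(** Two circuits with Ns/2 repetitions each, times a geometric sum of depths below 2^(J+1). *)
Lemma T_total_le J Ns : (T_total J Ns <= 4 * Ns./2 * 2 ^ J)%N.
Proof.
rewrite /T_total /rpe_run /run_depth.
rewrite -(pair_bigA _ (fun (jb : 'I_J.+1 * bool) (n : 'I_(Ns./2)) => (2 ^ jb.1)%N)) /=.
under eq_bigr do rewrite sum_nat_const card_ord.
rewrite -(pair_bigA _ (fun (j : 'I_J.+1) (b : bool) => (Ns./2 * 2 ^ j)%N)) /=.
under eq_bigr do rewrite sum_nat_const card_bool mulnA.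
rewrite -big_distrr /=.
have -> : (\sum_(i < J.+1) 2 ^ i = (2 ^ J.+1).-1)%N by rewrite predn_exp mul1n.
apply: leq_trans (leq_mul (leqnn _) (leq_pred _)) _.
by rewrite expnS mulnA (mulnAC 2 _ 2)%N.
Qed.

(** Uniformity in eta: one threshold c on eps has to serve every eta. *)
Lemma near_eps_eta (Q : R * R -> Prop) (c : R) : 0 < c ->
  (forall eps eta, 0 < eps < c -> 0 < eta < 1 -> Q (eps, eta)) ->
  \forall p \near eps_to_0_unif_eta, Q p.
Proof.
move=> c0 HQ; exists ([set eps | 0 < eps < c], [set eta | 0 < eta < 1]) => /=.
  split; last by move=> eta.
  near=> eps => /=; apply/andP; split; near: eps; first exact: nbhs_right_gt.
  exact: nbhs_right_lt.
by move=> [eps eta] [/= h1 h2]; exact: HQ.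
Unshelve. all: by end_near. Qed.

Lemma T_max_bigO delta :
  ((fun p => (T_max (rpe_J p.1) (rpe_Ns delta p.1 p.2))%:R) : R * R -> R^o)
    =O_eps_to_0_unif_eta (fun p => p.1^-1 : R^o).
Proof.
apply/eqO_exP; exists 2 => //.
apply: (@near_eps_eta _ 1) => // eps eta eps01 _ /=.
have /andP[eps0 _] := eps01.
rewrite !ger0_norm ?invr_ge0 ?(ltW eps0) //.
apply: le_trans (exp2_rpe_J_le eps01).
by rewrite -natrX ler_nat T_max_le.
Qed.

(* On [eps < exp (- e)] we have [ln (ln eps^-1) > 1], which absorbs all the constants. *)
Lemma T_total_bigO delta : 0 < rpe_alpha delta ->
  ((fun p => (T_total (rpe_J p.1) (rpe_Ns delta p.1 p.2))%:R) : R * R -> R^o)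
    =O_eps_to_0_unif_eta
    (fun p => p.1^-1 * (ln p.2^-1 + ln (ln p.1^-1)) : R^o).
Proof.
move=> al0; apply/eqO_exP; pose C := 4 / rpe_alpha delta ^+ 2.
have C0 : 0 < C by rewrite divr_gt0 ?exprn_gt0.
(* The 8 is 4 from [T_total_le] times 2 from 2^J <= 2 / eps; the rest bounds the number of
   repetitions, with 1 for its ceiling. *)
exists (8 * (5 * C + 1)); first by lra.
apply: (@near_eps_eta _ (expR (- expR 1))) => [|eps eta /andP[eps0 eps1] eta01 /=].
  exact: expR_gt0.
have /andP[eta0 eta1] := eta01.
have epsi : expR 1 < ln eps^-1.
  by rewrite lnV ?posrE // ltrNr -ltr_expR lnK ?posrE.
have lleps : 1 < ln (ln eps^-1).
  by rewrite -ltr_expR lnK // posrE (lt_trans _ epsi) ?expR_gt0.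
have leta : 0 <= ln eta^-1 by rewrite ln_ge0 // invf_ge1 // ltW.
set L := ln eta^-1 + ln (ln eps^-1).
have L1 : 1 <= L by rewrite /L; lra.
have e1 : 1 < expR 1 :> R by rewrite expR_gt1.
have eps01 : 0 < eps < 1.
  by rewrite eps0 (lt_trans eps1) // -[X in _ < X]expR0 ltr_expR oppr_lt0.
have ln2_le1 : ln 2 <= 1 :> R by rewrite [2]mulr2n le_ln1Dx //; lra.
have ln4 : ln 4 <= 2 :> R.
  have -> : 4 = 2 * 2 :> R by ring.
  by rewrite lnM ?posrE //; lra.
have ln2_ge : 1 / 2 <= ln 2 :> R.
  have := @le_ln1Dx R (- (1 / 2)).
  rewrite (_ : 1 - 1 / 2 = 2^-1 :> R); last by field.
  by rewrite lnV ?posrE // => h; have := h ltac:(lra); lra.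
(* Since ln 2 >= 1/2, the base 2 logarithm is at most 2 ln (1/eps); the ceiling and the added 1 cost
   at most 2, which is below 2 ln (1/eps). *)
have hJ : (rpe_J eps)%:R + 1 <= 4 * ln eps^-1.
  have l0 : 0 <= log2 eps^-1 by rewrite divr_ge0 //; lra.
  have := nceil_lt l0; rewrite -/(rpe_J eps).
  have : log2 eps^-1 <= 2 * ln eps^-1.
    rewrite /log2 ler_pdivrMr; last lra.
    rewrite mulrAC ler_peMl //; lra.
  lra.
have nL : (rpe_Ns delta eps eta)./2%:R <= (5 * C + 1) * L.
  rewrite rpe_half_Ns -/C; apply: ltW; apply: lt_le_trans (nceil_lt _) _.
    rewrite mulr_ge0 ?(ltW C0) // addr_ge0 // ln_ge0 ?lerDr //.
    by rewrite ler_pdivlMr // mul1r; lra.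
  rewrite lnM ?posrE ?invr_gt0 // mulrDl mul1r lerD //.
  (* The two logarithms together are at most 2 ln 4 + L <= 4 + L <= 5 L. *)
  have -> : 5 * C * L = C * (5 * L) by ring.
  rewrite ler_pM2l //.
  have : ln ((rpe_J eps)%:R + 1) <= ln (4 * ln eps^-1).
    by rewrite ler_ln ?posrE ?ltr_wpDl ?mulr_gt0 //; lra.
  rewrite lnM ?posrE //; last lra.
  by rewrite /L; lra.
rewrite !ger0_norm; last 2 first.
- by rewrite mulr_ge0 ?invr_ge0 ?(ltW eps0) //; lra.
- by [].
apply: (@le_trans _ _ (4 * ((5 * C + 1) * L) * (2 * eps^-1))).
  apply: le_trans (_ : _ <= (4 * (rpe_Ns delta eps eta)./2 * 2 ^ rpe_J eps)%:R) _.
    by rewrite ler_nat T_total_le.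
  rewrite !natrM natrX; apply: ler_pM; rewrite ?mulr_ge0 //.
    by rewrite ler_pM2l.
  exact: exp2_rpe_J_le.
by rewrite le_eqVlt; apply/orP; left; apply/eqP; ring.
Qed.

End Cost.

Theorem theorem2 (R : realType) (delta : R)
    (hdelta : delta < 2 * Num.sqrt 3 - 3)
    (hdelta' : 4 - 2 * Num.sqrt 3 < 1 - delta) :
  (forall (M : nat) (M_gt0 : (0 < M)%N)
      (U : 'M[R[i]]_M) (psis : 'I_M -> 'cV[R[i]]_M) (lambda : 'I_M -> R)
      (psi : 'cV[R[i]]_M) (eps eta : R)
      (d : measure_display) (T : measurableType d) (P : probability T R)
      (arg : R[i] -> R)
      (X : rpe_run (rpe_J eps) (rpe_Ns delta eps eta) -> {RV P >-> R})
      (theta : nat -> {RV P >-> R}),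
    let i0 := Ordinal M_gt0 in
    let p0 := (Normc.normc (braket psi (psis i0))) ^+ 2 in
    U \is unitarymx ->
    orthonormal_family psis ->
    (forall k, U *m psis k = expi (lambda k) *: psis k) ->
    braket psi psi = 1 ->
    0 < eps < 1 ->
    0 < eta < 1 ->
    1 - delta < p0 ->
    is_principal_arg arg ->
    hadamard_tests U psi X ->
    rpe_output arg X theta ->
    ((1 - eta)%:E <
      P [set w | angle_dist (theta (rpe_J eps) w - lambda i0)
                 < pi / 3 * eps]%R)%E)
  /\ ((fun p => (T_max (rpe_J p.1) (rpe_Ns delta p.1 p.2))%:R) : R * R -> R^o)
       =O_eps_to_0_unif_eta (fun p => p.1^-1 : R^o)
  /\ ((fun p => (T_total (rpe_J p.1) (rpe_Ns delta p.1 p.2))%:R) : R * R -> R^o)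
       =O_eps_to_0_unif_eta
       (fun p => p.1^-1 * (ln p.2^-1 + ln (ln p.1^-1)) : R^o).
Proof.
have al0 := rpe_alpha_gt0 hdelta.
split; last by split; [exact: T_max_bigO | exact: T_total_bigO].
move=> M M_gt0 U psis lambda psi eps eta d T P arg X theta i0 p0 _ on Upsi psi1.
move=> /andP[eps0 _] eta01 hp argP XP thetaP.
exact: rpe_correct hdelta on Upsi psi1 eps0 eta01 hp argP XP thetaP.
Qed.
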